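(* Let $k$ be a field of characteristic $p>0$ and let $N$ be a natural number. Let $A$ be any commutative $k$-algebra, let $\widetilde{A}=k\otimes_k A$, where $k$ maps to $k$ by the $N$th iterate of Frobenius $x\mapsto x^{p^N}$, and let $\varphi:\widetilde{A}\to A$ be the relative Frobenius homomorphism. View $\widetilde{A}\otimes_k A$ as a module over $\widetilde{A}\otimes_k\widetilde{A}$ via the ring homomorphism $x\otimes y\mapsto x\otimes\varphi(y)$, and view $\widetilde{A}$ as a module over $\widetilde{A}\otimes_k\widetilde{A}$ via $x\otimes y\mapsto xy$. Then $$\mathrm{Tor}_i^{\widetilde{A}\otimes_k\widetilde{A}}(\widetilde{A}\otimes_k A,\widetilde{A})\cong\begin{cases}A&\text{if }i=0\\0&\text{if }i>0.\end{cases}$$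
   Context: In $\widetilde{A}=k\otimes_k A$, one has $x\,c^{p^N}\otimes y=x\otimes cy$ for $x,c\in k$, $y\in A$. $\widetilde{A}$ is viewed as a $k$-algebra using the left copy of $k$. The relative Frobenius homomorphism $\varphi:\widetilde{A}\to A$ is the $k$-algebra homomorphism given by $\varphi(x\otimes y)=x\,y^{p^N}$ for $x\in k$, $y\in A$. *)

(* Defs.v *)
From HB Require Import structures.
From mathcomp Require Import all_boot all_order all_algebra.
From mathcomp Require Import boolp finmap monalg.

Set Implicit Arguments.
Unset Strict Implicit.
Unset Printing Implicit Defensive.

Import GRing.Theory.
Local Open Scope quotient_scope.
Local Open Scope ring_scope.

(* The trivial ring is not excluded: rings are of type comPzRingType, and an
   algebra over R is a ring B together with a ring morphism R -> B (the library
   type comAlgType only has nontrivial inhabitants). *)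

Definition lmod_iso (R : pzRingType) (U V : lmodType R) : Prop :=
  exists f : {linear U -> V}, bijective f.

Definition restr (R S : pzRingType) (f : {rmorphism R -> S}) (M : lmodType S)
  : Type := M.

Section RestrictionOfScalars.
Variables (R S : pzRingType) (f : {rmorphism R -> S}) (M : lmodType S).

HB.instance Definition _ := GRing.Zmodule.copy (restr f M) M.

Definition restr_scale (r : R) (m : restr f M) : restr f M := f r *: (m : M).

Fact restr_scaleA r s m :
  restr_scale r (restr_scale s m) = restr_scale (r * s) m.
Proof. by rewrite /restr_scale scalerA rmorphM. Qed.

Fact restr_scale1 : left_id 1 restr_scale.
Proof. by move=> m; rewrite /restr_scale rmorph1 scale1r. Qed.

Fact restr_scaleDr : right_distributive restr_scale +%R.
Proof. by move=> r m n; rewrite /restr_scale scalerDr. Qed.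

Fact restr_scaleDl m : {morph restr_scale^~ m : r s / r + s}.
Proof. by move=> r s; rewrite /restr_scale rmorphD scalerDl. Qed.

HB.instance Definition _ := GRing.Zmodule_isLmodule.Build R (restr f M)
  restr_scaleA restr_scale1 restr_scaleDr restr_scaleDl.

End RestrictionOfScalars.

Section QuotientModule.
Variables (R : pzRingType) (V : lmodType R) (W : submodClosed V).

Definition lquot_pred : {pred V} := W.

Fact lquot_pred_zmod : zmod_closed lquot_pred.
Proof.
apply: GRing.subsemimod_closedB; split; last exact: rpredZ.
by split; [exact: rpred0 | exact: rpredD].
Qed.

HB.instance Definition _ := GRing.isZmodClosed.Build V lquot_pred
  lquot_pred_zmod.

Definition lquot : Type := Quotient.quot lquot_pred.

HB.instance Definition _ := GRing.Zmodule.on lquot.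

Definition lquot_pi (v : V) : lquot := \pi_(Quotient.quot lquot_pred) v.
Definition lquot_repr (q : lquot) : V := @repr _ (Quotient.quot lquot_pred) q.

Lemma lquot_reprK : cancel lquot_repr lquot_pi.
Proof. by move=> q; apply: reprK. Qed.

Lemma lquot_piP u v : lquot_pi u = lquot_pi v <-> u - v \in W.
Proof.
rewrite -[_ \in W]/(u - v \in lquot_pred) Quotient.idealrBE.
by split=> [/eqP|/eqP].
Qed.

Lemma lquot_piD : {morph lquot_pi : u v / u + v}.
Proof. by move=> u v; rewrite /lquot_pi Quotient.pi_add. Qed.

Definition lquot_scale (r : R) (q : lquot) : lquot :=
  lquot_pi (r *: lquot_repr q).

Lemma lquot_scale_pi r v : lquot_scale r (lquot_pi v) = lquot_pi (r *: v).
Proof.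
apply/lquot_piP; rewrite -scalerBr; apply: rpredZ.
by apply/lquot_piP; rewrite lquot_reprK.
Qed.

Fact lquot_scaleA r s q :
  lquot_scale r (lquot_scale s q) = lquot_scale (r * s) q.
Proof. by rewrite -[q]lquot_reprK !lquot_scale_pi scalerA. Qed.

Fact lquot_scale1 : left_id 1 lquot_scale.
Proof. by move=> q; rewrite -[q]lquot_reprK !lquot_scale_pi scale1r. Qed.

Fact lquot_scaleDr : right_distributive lquot_scale +%R.
Proof.
move=> r q q'; rewrite -[q]lquot_reprK -[q']lquot_reprK.
by rewrite -lquot_piD !lquot_scale_pi -lquot_piD scalerDr.
Qed.

Fact lquot_scaleDl q : {morph lquot_scale^~ q : r s / r + s}.
Proof.
by move=> r s; rewrite -[q]lquot_reprK !lquot_scale_pi -lquot_piD scalerDl.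
Qed.

HB.instance Definition _ := GRing.Zmodule_isLmodule.Build R lquot
  lquot_scaleA lquot_scale1 lquot_scaleDr lquot_scaleDl.

Fact lquot_pi_linear : linear lquot_pi.
Proof. by move=> r u v; rewrite lquot_piD -lquot_scale_pi. Qed.

HB.instance Definition _ := GRing.isLinear.Build R V lquot _ lquot_pi
  lquot_pi_linear.

End QuotientModule.

Section QuotientLift.
Variables (R : pzRingType) (V X : lmodType R) (W : submodClosed V).
Variable f : {linear V -> X}.
Hypothesis f0 : forall v, v \in W -> f v = 0.

Definition lquot_lift of (forall v, v \in W -> f v = 0) :=
  fun q : lquot W => f (lquot_repr q).

Lemma lquot_lift_pi v : lquot_lift f0 (lquot_pi W v) = f v.
Proof.
apply/eqP; rewrite -subr_eq0 -raddfB; apply/eqP/f0/lquot_piP.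
exact: lquot_reprK.
Qed.

Fact lquot_lift_linear : linear (lquot_lift f0).
Proof.
move=> r q q'; rewrite -[q]lquot_reprK -[q']lquot_reprK.
by rewrite -linearP !lquot_lift_pi linearP.
Qed.

HB.instance Definition _ := GRing.isLinear.Build R (lquot W) X _
  (lquot_lift f0) lquot_lift_linear.

End QuotientLift.

Section Submodules.
Variables (R : pzRingType) (U V : lmodType R).

Definition lker_pred (f : U -> V) : {pred U} := fun u => f u == 0.

Fact lker_closed (f : {linear U -> V}) : subsemimod_closed (lker_pred f).
Proof.
split; last first.
  by move=> r u; rewrite !unfold_in /= linearZ /= => /eqP->; rewrite scaler0.
split=> [|u v]; rewrite !unfold_in /= ?linear0 // linearD.
by move=> /eqP-> /eqP->; rewrite addr0.
Qed.

HB.instance Definition _ (f : {linear U -> V}) :=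
  GRing.isAddClosed.Build U (lker_pred f) (lker_closed f).1.
HB.instance Definition _ (f : {linear U -> V}) :=
  GRing.isScaleClosed.Build R U (lker_pred f) (lker_closed f).2.

Record lkernel (f : {linear U -> V}) : Type :=
  LKernel { lkernel_val :> U; lkernel_valP : lker_pred f lkernel_val }.

HB.instance Definition _ (f : {linear U -> V}) := [isSub of lkernel f for @lkernel_val f].
HB.instance Definition _ (f : {linear U -> V}) := [Choice of lkernel f by <:].
HB.instance Definition _ (f : {linear U -> V}) := GRing.SubChoice_isSubLmodule.Build R U
  (lker_pred f) (lkernel f) (lker_closed f).

Definition limage_pred (f : U -> V) : {pred V} := fun v =>
  `[< exists u, f u = v >].

Fact limage_closed (f : {linear U -> V}) : subsemimod_closed (limage_pred f).
Proof.
split; last first.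
  by move=> r _ /asboolP[u <-]; apply/asboolP; exists (r *: u); rewrite linearZ.
split=> [|_ _ /asboolP[u <-] /asboolP[u' <-]]; apply/asboolP.
  by exists 0; rewrite linear0.
by exists (u + u'); rewrite linearD.
Qed.

HB.instance Definition _ (f : {linear U -> V}) :=
  GRing.isAddClosed.Build V (limage_pred f) (limage_closed f).1.
HB.instance Definition _ (f : {linear U -> V}) :=
  GRing.isScaleClosed.Build R V (limage_pred f) (limage_closed f).2.

End Submodules.

Section Span.
Variables (R : pzRingType) (V : lmodType R).
Implicit Type S : V -> Prop.

Definition lspan S : {pred V} := fun v =>
  `[< forall W : submodClosed V, (forall s, S s -> s \in W) -> v \in W >].

Fact lspan_closed S : subsemimod_closed (lspan S).
Proof.
split; last first.
  by move=> r v /asboolP hv; apply/asboolP=> W hW; apply/rpredZ/hv.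
split=> [|u v /asboolP hu /asboolP hv]; apply/asboolP=> W hW.
  exact: rpred0.
by apply: rpredD; [exact: hu | exact: hv].
Qed.

HB.instance Definition _ S :=
  GRing.isAddClosed.Build V (lspan S) (lspan_closed S).1.
HB.instance Definition _ S :=
  GRing.isScaleClosed.Build R V (lspan S) (lspan_closed S).2.

Lemma lspan_gen S s : S s -> s \in lspan S.
Proof. by move=> Ss; apply/asboolP=> W; apply. Qed.

Lemma lspan_eq0 S (X : lmodType R) (f : {linear V -> X}) :
  (forall s, S s -> f s = 0) -> forall v, v \in lspan S -> f v = 0.
Proof.
move=> f0 v /asboolP/(_ (lker_pred f)) hv; apply/eqP/hv => s Ss.
by apply/eqP/f0.
Qed.

End Span.

Section FreeModule.
Variables (R : pzRingType) (K : choiceType).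

(* Finitely supported functions K -> R.  The library makes {malg R[K]} a module
   only when R is a nontrivial ring. *)
Definition free : Type := {malg R[K]}.

HB.instance Definition _ := GRing.Zmodule.on free.

Definition free_scale (r : R) (v : free) : free :=
  [malg k in msupp v => r * v@_k].

Fact free_scaleE r v k : (free_scale r v)@_k = r * v@_k.
Proof. by rewrite mcoeffE; case: msuppP; rewrite ?mulr0. Qed.

Fact free_scaleA r s v : free_scale r (free_scale s v) = free_scale (r * s) v.
Proof. by apply/malgP=> k; rewrite !free_scaleE mulrA. Qed.

Fact free_scale1 : left_id 1 free_scale.
Proof. by move=> v; apply/malgP=> k; rewrite free_scaleE mul1r. Qed.

Fact free_scaleDr : right_distributive free_scale +%R.
Proof.
by move=> r u v; apply/malgP=> k; rewrite !(free_scaleE, mcoeffD) mulrDr.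
Qed.

Fact free_scaleDl v : {morph free_scale^~ v : r s / r + s}.
Proof.
by move=> r s; apply/malgP=> k; rewrite !(free_scaleE, mcoeffD) mulrDl.
Qed.

HB.instance Definition _ := GRing.Zmodule_isLmodule.Build R free
  free_scaleA free_scale1 free_scaleDr free_scaleDl.

Definition fgen (k : K) : free := << 1 *g k >>.

Lemma free_sumE (v : free) : v = \sum_(k <- msupp v) v@_k *: fgen k.
Proof.
rewrite {1}[v]monalgE; apply: eq_bigr => k _; apply/malgP=> k'.
by rewrite free_scaleE !mcoeffU mulrnAr mulr1.
Qed.

Variables (X : lmodType R) (g : K -> X).

Definition free_lift (v : free) : X := \sum_(k <- msupp v) v@_k *: g k.

Lemma free_lift_w (D : {fset K}) (v : free) : (msupp v `<=` D)%fset ->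
  free_lift v = \sum_(k <- D) v@_k *: g k.
Proof.
move=> sub; rewrite /free_lift; apply: big_fset_incl => // k _ kv.
by rewrite mcoeff_outdom // scale0r.
Qed.

Fact free_lift_linear : linear free_lift.
Proof.
move=> r u v; pose D := (msupp u `|` msupp v `|` msupp (r *: u + v))%fset.
have subs w : w \in [:: u; v; r *: u + v] -> (msupp w `<=` D)%fset.
  move=> hw; apply/fsubsetP=> k kw; rewrite !inE.
  by move: hw kw; rewrite !inE => /or3P[] /eqP-> ->; rewrite ?orbT.
rewrite !(@free_lift_w D) ?subs ?inE ?eqxx ?orbT // scaler_sumr -big_split /=.
by apply: eq_bigr => k _; rewrite mcoeffD free_scaleE scalerDl scalerA.
Qed.

HB.instance Definition _ := GRing.isLinear.Build R free X _ free_lift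
  free_lift_linear.

Lemma free_lift_gen k : free_lift (fgen k) = g k.
Proof.
rewrite (@free_lift_w [fset k]%fset) ?msuppU_le // big_seq_fset1.
by rewrite mcoeffUU scale1r.
Qed.

End FreeModule.

Section Tensor.
Variables (R : comPzRingType) (M N : lmodType R).

Local Notation F := (free R (M * N)%type).
Local Notation g m n := (fgen R (m, n)).

Variant tensor_rel : F -> Prop :=
  | TensorDl m m' n : tensor_rel (g (m + m') n - (g m n + g m' n))
  | TensorDr m n n' : tensor_rel (g m (n + n') - (g m n + g m n'))
  | TensorZl r m n : tensor_rel (g (r *: m) n - r *: g m n)
  | TensorZr r m n : tensor_rel (g m (r *: n) - r *: g m n).

Definition tensor : Type := lquot (lspan tensor_rel).

HB.instance Definition _ := GRing.Lmodule.on tensor.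

End Tensor.

(* tens and tensor_lift are locked because unification otherwise unfolds the
   quotient. *)
HB.lock Definition tens (R : comPzRingType) (M N : lmodType R) (m : M) (n : N) :
  tensor M N := lquot_pi (lspan (@tensor_rel R M N)) (fgen R (m, n)).

Arguments tens {R M N} m n.

Section TensorTheory.
Variables (R : comPzRingType) (M N : lmodType R).
Implicit Types (m : M) (n : N).

Local Notation tensor_rel := (@tensor_rel R M N).
Local Notation tensor := (tensor M N).

Lemma tensor_relP u v : tensor_rel (u - v) ->
  lquot_pi (lspan tensor_rel) u = lquot_pi (lspan tensor_rel) v.
Proof. by move=> uv; apply/lquot_piP/lspan_gen. Qed.

Lemma tensDl m m' n : tens (m + m') n = tens m n + tens m' n.
Proof. by rewrite tens.unlock (tensor_relP (TensorDl m m' n)) linearD. Qed.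

Lemma tensDr m n n' : tens m (n + n') = tens m n + tens m n'.
Proof. by rewrite tens.unlock (tensor_relP (TensorDr m n n')) linearD. Qed.

Lemma tensZl r m n : tens (r *: m) n = r *: tens m n.
Proof. by rewrite tens.unlock (tensor_relP (TensorZl r m n)) linearZ. Qed.

Lemma tensZr r m n : tens m (r *: n) = r *: tens m n.
Proof. by rewrite tens.unlock (tensor_relP (TensorZr r m n)) linearZ. Qed.

Lemma tensor_ind (P : tensor -> Prop) :
    (forall m n, P (tens m n)) -> (forall t u, P t -> P u -> P (t + u)) ->
  forall t, P t.
Proof.
move=> Pt PD t; rewrite -[t]lquot_reprK [lquot_repr t]free_sumE linear_sum.
apply: (big_ind P) => // [|[m n] _].
  by rewrite -(scale0r (tens 0 0)) -tensZl; exact: Pt.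
rewrite linearZ; have := Pt (((lquot_repr t)@_(m, n)) *: m) n.
by rewrite tensZl tens.unlock.
Qed.

Definition bilin (X : lmodType R) (b : M -> N -> X) : Prop :=
  (forall n, linear (b^~ n)) /\ (forall m, linear (b m)).

Fact tens_bilin : bilin tens.
Proof.
by split=> [n r m m'|m r n n']; rewrite ?tensDl ?tensDr ?tensZl ?tensZr.
Qed.

Section Lift.
Variables (X : lmodType R) (b : M -> N -> X).
Hypothesis bP : bilin b.

Fact tensor_lift_subproof v : v \in lspan tensor_rel ->
  free_lift (fun mn => b mn.1 mn.2) v = 0.
Proof.
have [bl br] := bP.
have b0l n : b 0 n = 0.
  by apply: (addIr (b 0 n)); rewrite add0r -{1}(scale1r (b 0 n)) -bl scaler0 addr0.
have b0r m : b m 0 = 0.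
  by apply: (addIr (b m 0)); rewrite add0r -{1}(scale1r (b m 0)) -br scaler0 addr0.
apply: lspan_eq0 => {}v; case=> [m m' n|m n n'|r m n|r m n]; apply/eqP;
  rewrite linearB subr_eq0 ?linearD ?linearZ /= !free_lift_gen /=; apply/eqP.
- by rewrite -[m]scale1r bl !scale1r.
- by rewrite -[n]scale1r br !scale1r.
- by rewrite -[r *: m]addr0 bl b0l addr0.
- by rewrite -[r *: n]addr0 br b0r addr0.
Qed.

End Lift.
End TensorTheory.

HB.lock Definition tensor_lift (R : comPzRingType) (M N X : lmodType R)
    (b : M -> N -> X) (bP : bilin b) : tensor M N -> X :=
  lquot_lift (tensor_lift_subproof bP).

Arguments tensor_lift {R M N X b} bP t.

Section TensorLift.
Variables (R : comPzRingType) (M N X : lmodType R) (b : M -> N -> X).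
Hypothesis bP : bilin b.

Fact tensor_lift_linear : linear (tensor_lift bP).
Proof. by rewrite tensor_lift.unlock; apply: lquot_lift_linear. Qed.

HB.instance Definition _ :=
  GRing.isLinear.Build R (tensor M N) X _ (tensor_lift bP) tensor_lift_linear.

Lemma tensor_lift_tens m n : tensor_lift bP (tens m n) = b m n.
Proof.
by rewrite tensor_lift.unlock tens.unlock lquot_lift_pi /= free_lift_gen.
Qed.

End TensorLift.

Section TensorMap.
Variables (R : comPzRingType) (M M' N N' : lmodType R).
Variables (f : {linear M -> M'}) (g : {linear N -> N'}).

Fact tensor_map_subproof : bilin (fun m n => tens (f m) (g n)).
Proof.
by split=> [n r m m'|m r n n'] /=; rewrite linearP ?(tens_bilin _ _).1 ?(tens_bilin _ _).2.
Qed.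

Definition tensor_map : tensor M N -> tensor M' N' :=
  tensor_lift tensor_map_subproof.

HB.instance Definition _ := GRing.Linear.on tensor_map.

Lemma tensor_map_tens m n : tensor_map (tens m n) = tens (f m) (g n).
Proof. exact: tensor_lift_tens. Qed.

End TensorMap.

Section Homology.
Variables (R : pzRingType) (X Y Z : lmodType R).
Variables (f : {linear X -> Y}) (g : {linear Y -> Z}).

(* ker g / (ker g \cap im f) *)
Definition boundary_pred : {pred lkernel g} := fun z => limage_pred f (val z).

Fact boundary_closed : subsemimod_closed boundary_pred.
Proof.
split; last by move=> r z hz; rewrite unfold_in /boundary_pred linearZ; apply: rpredZ.
split=> [|u v hu hv]; rewrite unfold_in /boundary_pred.
  by rewrite raddf0; apply: rpred0.
by rewrite raddfD; apply: rpredD.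
Qed.

HB.instance Definition _ :=
  GRing.isAddClosed.Build (lkernel g) boundary_pred boundary_closed.1.
HB.instance Definition _ :=
  GRing.isScaleClosed.Build R (lkernel g) boundary_pred boundary_closed.2.

Definition homology : Type := lquot boundary_pred.

HB.instance Definition _ := GRing.Lmodule.on homology.

End Homology.

Section Tor.
Variables (R : comPzRingType) (M N : lmodType R).

(* The canonical free resolution of N: its n-th term is the free module on the
   elements of the n-th syzygy, where the 0-th syzygy is N itself and the
   (n+1)-st is the kernel of the tautological surjection onto the n-th. *)
Definition free_eval (X : lmodType R) : free R X -> X := free_lift id.

HB.instance Definition _ X := GRing.Linear.on (@free_eval X).

Fixpoint syz (n : nat) : lmodType R :=
  if n is m.+1 then lkernel (@free_eval (syz m)) else N.

Definition resol (n : nat) : lmodType R := free R (syz n).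

Definition resol_d (n : nat) : resol n.+1 -> resol n :=
  fun v => lkernel_val (@free_eval (syz n.+1) v).

Fact resol_d_linear n : linear (@resol_d n).
Proof. by move=> r u v; rewrite /resol_d linearP. Qed.

HB.instance Definition _ n :=
  GRing.isLinear.Build R (resol n.+1) (resol n) _ (@resol_d n) (@resol_d_linear n).

Lemma free_eval_surj (X : lmodType R) (x : X) : exists v, free_eval v = x.
Proof. by exists (fgen R x); apply: free_lift_gen. Qed.

Lemma resol_exact n (v : resol n) :
  free_eval v = 0 <-> exists w, @resol_d n w = v.
Proof.
split=> [/eqP v0|[w <-]]; last exact/eqP/lkernel_valP.
by exists (fgen R (LKernel v0 : syz n.+1)); rewrite /resol_d /free_eval free_lift_gen.
Qed.

Lemma resol_d_eq0 n (v : resol n.+1) : resol_d v = 0 <-> free_eval v = 0.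
Proof. by split=> [v0|]; [exact: val_inj | rewrite /resol_d => ->]. Qed.

(* Tor_n(M, N) is computed by resolving the second argument; the differential
   of M (x) P out of degree 0 is zero. *)
Definition Tor_d (n : nat) : {linear tensor M (resol n) -> tensor M (resol n.-1)} :=
  if n is m.+1 then tensor_map idfun (@resol_d m) else \0.

Definition Tor (n : nat) : lmodType R := homology (Tor_d n.+1) (Tor_d n).

End Tor.

Section TensorAlgebra.
Variables (R B C : comPzRingType).
Variables (f : {rmorphism R -> B}) (g : {rmorphism R -> C}).

Local Notation Bm := (restr f B^o).
Local Notation Cm := (restr g C^o).

(* B (x)_R C: the defining relations give f r * b (x) c = b (x) g r * c. *)
Definition tensA : Type := tensor Bm Cm.

HB.instance Definition _ := GRing.Lmodule.on tensA.

Definition ptens (b : B) (c : C) : tensA := @tens R Bm Cm b c.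

Lemma ptensDl b b' c : ptens (b + b') c = ptens b c + ptens b' c.
Proof. exact: (@tensDl R Bm Cm). Qed.

Lemma ptensDr b c c' : ptens b (c + c') = ptens b c + ptens b c'.
Proof. exact: (@tensDr R Bm Cm). Qed.

Lemma ptensZl r b c : ptens (f r * b) c = r *: ptens b c.
Proof. exact: (@tensZl R Bm Cm). Qed.

Lemma ptensZr r b c : ptens b (g r * c) = r *: ptens b c.
Proof. exact: (@tensZr R Bm Cm). Qed.

Lemma tensA_ind (P : tensA -> Prop) :
    (forall b c, P (ptens b c)) -> (forall t u, P t -> P u -> P (t + u)) ->
  forall t, P t.
Proof. exact: (@tensor_ind R Bm Cm). Qed.

Definition restr_mul (S : comPzRingType) (h : {rmorphism R -> S}) (s : S) :
  restr h S^o -> restr h S^o := fun x => s * (x : S).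

Arguments restr_mul [S] h s x.

Fact restr_mul_linear (S : comPzRingType) (h : {rmorphism R -> S}) s :
  linear (restr_mul h s).
Proof.
by move=> r x y; rewrite [LHS]mulrDr; congr (_ + _); apply: mulrCA.
Qed.

HB.instance Definition _ (S : comPzRingType) (h : {rmorphism R -> S}) s :=
  GRing.isLinear.Build R (restr h S^o) (restr h S^o) _ (restr_mul h s)
    (@restr_mul_linear S h s).

Definition tensA_mulp (b : B) (c : C) : tensA -> tensA :=
  tensor_map (restr_mul f b) (restr_mul g c).

HB.instance Definition _ b c := GRing.Linear.on (tensA_mulp b c).

Lemma tensA_mulpE b c b' c' :
  tensA_mulp b c (ptens b' c') = ptens (b * b') (c * c').
Proof. exact: tensor_map_tens. Qed.

Fact tensA_mulpD b c : {morph tensA_mulp b c : t u / t + u}.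
Proof. exact: linearD. Qed.

Fact tensA_mulp_bilin (u : tensA) :
  @bilin R Bm Cm tensA (fun b c => tensA_mulp b c u).
Proof.
split=> [c r b b'|b r c c'] /=; elim/tensA_ind: u => [x y|u v IHu IHv].
- by rewrite !tensA_mulpE [X in ptens X]mulrDl ptensDl -mulrA ptensZl.
- by rewrite !tensA_mulpD IHu IHv scalerDr addrACA.
- by rewrite !tensA_mulpE [X in ptens _ X]mulrDl ptensDr -mulrA ptensZr.
- by rewrite !tensA_mulpD IHu IHv scalerDr addrACA.
Qed.

Definition tensA_mul (t u : tensA) : tensA := tensor_lift (tensA_mulp_bilin u) t.

Definition tensA_one : tensA := ptens 1 1.

Fact tensA_mulE b c u : tensA_mul (ptens b c) u = tensA_mulp b c u.
Proof. exact: tensor_lift_tens. Qed.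

Fact tensA_mulDl : left_distributive tensA_mul +%R.
Proof. by move=> t t' u; apply: linearD. Qed.

Fact tensA_mulDr : right_distributive tensA_mul +%R.
Proof.
move=> t u v; elim/tensA_ind: t => [b c|t t' IH IH'].
  by rewrite !tensA_mulE tensA_mulpD.
by rewrite !tensA_mulDl IH IH' addrACA.
Qed.

Fact tensA_mulC : commutative tensA_mul.
Proof.
move=> t u; elim/tensA_ind: t => [b c|t t' IH IH']; last first.
  by rewrite tensA_mulDl tensA_mulDr IH IH'.
elim/tensA_ind: u => [b' c'|u u' IH IH']; last first.
  by rewrite tensA_mulDl tensA_mulDr IH IH'.
by rewrite !tensA_mulE !tensA_mulpE mulrC [c * _]mulrC.
Qed.

Fact tensA_mulA : associative tensA_mul.
Proof.
move=> t u v; elim/tensA_ind: t => [b c|t t' IH IH']; last first.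
  by rewrite !tensA_mulDl IH IH'.
elim/tensA_ind: u => [b' c'|u u' IH IH']; last first.
  by rewrite !(tensA_mulDl, tensA_mulDr) IH IH'.
elim/tensA_ind: v => [b'' c''|v v' IH IH']; last first.
  by rewrite !tensA_mulDr IH IH'.
by rewrite !(tensA_mulE, tensA_mulpE) !mulrA.
Qed.

Fact tensA_mul1 : left_id tensA_one tensA_mul.
Proof.
move=> t; elim/tensA_ind: t => [b c|t t' IH IH'].
  by rewrite tensA_mulE tensA_mulpE !mul1r.
by rewrite tensA_mulDr IH IH'.
Qed.

HB.instance Definition _ := GRing.Zmodule_isComPzRing.Build tensA
  tensA_mulA tensA_mulC tensA_mul1 tensA_mulDl.

Lemma ptensM b c b' c' : ptens b c * ptens b' c' = ptens (b * b') (c * c').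
Proof. by rewrite -tensA_mulpE -tensA_mulE. Qed.

Definition tinl (b : B) : tensA := ptens b 1.
Definition tinr (c : C) : tensA := ptens 1 c.

Fact tinl_nmod : nmod_morphism tinl.
Proof.
split=> [|b b']; last exact: ptensDl.
by apply: (addrI (tinl 0)); rewrite -ptensDl !addr0.
Qed.

Fact tinl_monoid : monoid_morphism tinl.
Proof. by split=> // b b'; rewrite ptensM mulr1. Qed.

HB.instance Definition _ := GRing.isNmodMorphism.Build B tensA tinl tinl_nmod.
HB.instance Definition _ := GRing.isMonoidMorphism.Build B tensA tinl tinl_monoid.

Fact tinr_nmod : nmod_morphism tinr.
Proof.
split=> [|c c']; last exact: ptensDr.
by apply: (addrI (tinr 0)); rewrite -ptensDr !addr0.
Qed.

Fact tinr_monoid : monoid_morphism tinr.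
Proof. by split=> // c c'; rewrite ptensM mulr1. Qed.

HB.instance Definition _ := GRing.isNmodMorphism.Build C tensA tinr tinr_nmod.
HB.instance Definition _ := GRing.isMonoidMorphism.Build C tensA tinr tinr_monoid.

Lemma tinlf_tinrg r : tinl (f r) = tinr (g r).
Proof. by rewrite /tinl /tinr -[f r]mulr1 -[g r]mulr1 ptensZl ptensZr. Qed.

Section Lift.
Variables (D : comPzRingType) (u : {rmorphism B -> D}) (v : {rmorphism C -> D}).
Hypothesis uv : forall r, u (f r) = v (g r).

Fact tensA_lift_bilin :
  @bilin R Bm Cm (restr (u \o f) D^o) (fun b c => u b * v c : D).
Proof.
split=> [c r b b'|b r c c'] /=.
  by rewrite rmorphD rmorphM mulrDl -mulrA.
by rewrite rmorphD rmorphM mulrDr mulrCA -uv.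
Qed.

Definition tensA_lift (t : tensA) : D := tensor_lift tensA_lift_bilin t.

Lemma tensA_liftE b c : tensA_lift (ptens b c) = u b * v c.
Proof. exact: (tensor_lift_tens tensA_lift_bilin b c). Qed.

Fact tensA_lift_nmod : nmod_morphism tensA_lift.
Proof.
by split=> [|t t']; [exact: (linear0 (tensor_lift tensA_lift_bilin))
  | exact: (linearD (tensor_lift tensA_lift_bilin))].
Qed.

Fact tensA_lift_monoid : monoid_morphism tensA_lift.
Proof.
split=> [|t t']; first by rewrite tensA_liftE !rmorph1 mulr1.
elim/tensA_ind: t => [b c|t1 t2 IH1 IH2]; last first.
  by rewrite mulrDl !tensA_lift_nmod.2 IH1 IH2 mulrDl.
elim/tensA_ind: t' => [b' c'|t1 t2 IH1 IH2]; last first.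
  by rewrite mulrDr !tensA_lift_nmod.2 IH1 IH2 mulrDr.
by rewrite ptensM !tensA_liftE !rmorphM mulrACA.
Qed.

HB.instance Definition _ :=
  GRing.isNmodMorphism.Build tensA D tensA_lift tensA_lift_nmod.
HB.instance Definition _ :=
  GRing.isMonoidMorphism.Build tensA D tensA_lift tensA_lift_monoid.

End Lift.
End TensorAlgebra.

(* The proof argument charkp and the structure map a do not occur in the body:
   they make frob charkp N a a ring morphism. *)
Definition frob (k : fieldType) (p : nat) (charkp : p \in [pchar k]) (N : nat)
  (A : comPzRingType) (a : {rmorphism k -> A}) (x : A) : A := x ^+ (p ^ N).

Section Frobenius.
Variables (k : fieldType) (p : nat) (charkp : p \in [pchar k]) (N : nat).
Variables (A : comPzRingType) (a : {rmorphism k -> A}).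

Fact frobD1 (x y : A) : (x + y) ^+ p = x ^+ p + y ^+ p.
Proof.
have defp := prednK (prime_gt0 (pcharf_prime charkp)).
rewrite exprDn big_ord_recr subnn -defp big_ord_recl /= defp.
rewrite subn0 mulr1 mul1r bin0 binn big1 ?addr0 // => i _.
rewrite -mulr_natl -(rmorph_nat a) bin_lt_pcharf_0 ?rmorph0 ?mul0r //=.
by rewrite -{2}defp ltnS (valP i).
Qed.

Fact frob_nmod : nmod_morphism (frob charkp N a).
Proof.
have p_gt0 := prime_gt0 (pcharf_prime charkp).
split=> [|x y]; rewrite /frob; first by rewrite expr0n -leqn0 leqNgt expn_gt0 p_gt0.
by elim: N => [|n IHn]; rewrite ?expn0 ?expr1 // expnSr !exprM IHn frobD1.
Qed.

Fact frob_monoid : monoid_morphism (frob charkp N a).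
Proof. by split=> [|x y]; rewrite /frob ?expr1n ?exprMn. Qed.

HB.instance Definition _ :=
  GRing.isNmodMorphism.Build A A (frob charkp N a) frob_nmod.
HB.instance Definition _ :=
  GRing.isMonoidMorphism.Build A A (frob charkp N a) frob_monoid.

End Frobenius.

Section RelativeFrobenius.
Variables (k : fieldType) (p : nat) (charkp : p \in [pchar k]) (N : nat).
Variables (A : comPzRingType) (a : {rmorphism k -> A}).

Local Notation frobk := (frob charkp N (idfun : {rmorphism k -> k})).

Definition Atilde : comPzRingType := tensA frobk a.

Definition Atilde_alg : {rmorphism k -> Atilde} := tinl frobk a.

Fact relfrob_subproof c : a (frobk c) = frob charkp N a (a c).
Proof. by rewrite /frob rmorphXn. Qed.

Definition relfrob : {rmorphism Atilde -> A} := tensA_lift relfrob_subproof.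

Lemma relfrobE x y : relfrob (ptens _ _ x y) = a x * y ^+ (p ^ N).
Proof. exact: tensA_liftE. Qed.

Definition Atilde_Atilde : comPzRingType := tensA Atilde_alg Atilde_alg.
Definition Atilde_A : comPzRingType := tensA Atilde_alg a.

Fact id_relfrob_subproof c :
  tinl Atilde_alg a (Atilde_alg c) = (tinr Atilde_alg a \o relfrob) (Atilde_alg c).
Proof. by rewrite /= relfrobE expr1n mulr1 tinlf_tinrg. Qed.

Definition id_relfrob : {rmorphism Atilde_Atilde -> Atilde_A} :=
  tensA_lift id_relfrob_subproof.

Lemma id_relfrobE x y :
  id_relfrob (ptens _ _ x y) = ptens Atilde_alg a x (relfrob y).
Proof. by rewrite [LHS]tensA_liftE /tinl /= /tinr ptensM mulr1 mul1r. Qed.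

Definition Atilde_mul : {rmorphism Atilde_Atilde -> Atilde} :=
  tensA_lift (u := idfun) (v := idfun) (fun c => erefl).

Lemma Atilde_mulE x y : Atilde_mul (ptens _ _ x y) = x * y.
Proof. exact: tensA_liftE. Qed.

End RelativeFrobenius.

(* Main.v *)
From HB Require Import structures.
From mathcomp Require Import all_boot all_order all_algebra.
From mathcomp Require Import boolp classical_sets finmap monalg.
Require Import Defs.

(** Frobenius enters only through its being a homomorphism of k-algebras: for
    any k-algebras B, C and any k-algebra map phi : B -> C, the groups
    Tor_i over R = B (x)_k B of B (x)_k C (via id (x) phi) and B (via the
    multiplication mu) are C for i = 0 and 0 for i > 0.

    Let j : B -> R be the inclusion of the right factor, and regard R-modules
    as B-modules along j.  Then B (x)_k C = R (x)_B C is extended from the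
    B-module C, so that (B (x)_k C) (x)_R P = C (x)_B P depends only on the
    B-module underlying P ([extended_along_tinr]): it is functorial in maps P -> P'
    that are merely B-linear.

    It remains to see that the free resolution P of B over R is contractible
    over B.  As k is a field, surjections of k-modules split
    ([linear_section], by Zorn's lemma), hence R = B (x)_k B, which is induced
    from k along j, is projective over B
    ([projective_along_tensor_square]), and so are all free R-modules
    ([projective_along_free]).  The module B is free of rank one over B, because
    mu j = id ([projective_along_diag]).  A kernel of a B-split surjection
    between B-projectives is again B-projective ([projective_along_ker]), so by
    induction every surjection P_n -> Z_n of the resolution onto its syzygy has
    a B-linear section s_n; with e_n this surjection,
    h_n = s_(n+1) (1 - s_n e_n) is a contracting homotopy ([resol_homotopy]).
    Applying the functor to it kills the homology in positive degrees
    ([Tor_eq0]), and identifies the homology in degree 0 with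
    (B (x)_k C) (x)_R B ([Tor0_iso]), which is C ([tensor_diag_iso]). *)

Set Implicit Arguments.
Unset Strict Implicit.
Unset Printing Implicit Defensive.

Import GRing.Theory.
Local Open Scope ring_scope.

(** * Surjections of vector spaces split *)

Section LinearSection.
Variables (k : fieldType) (X Y : lmodType k) (pi : {linear X -> Y}).

Let independent (W : set X) : Prop :=
  (forall (c : k) u v, W u -> W v -> W (c *: u + v)) /\
  (forall u, W u -> pi u = 0 -> u = 0).

(** By Zorn's lemma there is a maximal subspace W that meets the kernel
    trivially.  If W + ker pi missed x, then W + k x would be larger; here a
    nonzero coefficient of x has to be inverted, which is where the field
    comes in. *)
Lemma exists_complement_ker :
  exists W : set X, [/\ W 0, (forall (c : k) u v, W u -> W v -> W (c *: u + v)),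
    (forall u, W u -> pi u = 0 -> u = 0) &
    forall x, exists2 w, W w & pi w = pi x].
Proof.
have [F FP tot|W [[Wlin Wker] Wmax]] := @Zorn_bigcup X independent.
  split=> [c u v [U FU Uu] [V FV Vv]|u [U FU Uu]]; last exact: (FP U FU).2.
  have [UV|VU] := tot U V FU FV.
  - by exists V => //; apply: (FP V FV).1 => //; apply: UV.
  - by exists U => //; apply: (FP U FU).1 => //; apply: VU.
have W0 : W 0.
  (* The empty set satisfies the conditions too (it is the union of the empty
     chain), so that W 0 also has to come from maximality. *)
  apply: contrapT => nW0; apply: (Wmax [set u | W u \/ u = 0]%classic).
    split=> [u Wu|sub]; first by left.
    by apply: nW0; apply: sub; right.
  split=> [c u v [Wu|->] [Wv|->]|u [Wu|->]]; rewrite ?addr0 ?scaler0 ?add0r //.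
  - by left; apply: (Wlin).
  - left; have := Wlin (c - 1) u u Wu Wu.
    by rewrite scalerBl scale1r subrK.
  - by left.
  - by right.
  - exact: Wker.
exists W; split=> // x; apply: contrapT => nx.
apply: (Wmax [set u | exists c w, W w /\ u = c *: x + w]%classic).
  split=> [u Wu|sub]; first by exists 0, u; rewrite scale0r add0r.
  by apply: nx; exists x => //; apply: sub; exists 1, 0; rewrite scale1r addr0.
split=> [c _ _ [c1 [w1 [W1 ->]]] [c2 [w2 [W2 ->]]]|_ [c [w [Ww ->]]]].
  exists (c * c1 + c2), (c *: w1 + w2); split; first exact: Wlin.
  by rewrite scalerDr scalerDl scalerA addrACA.
have [->|c0] := eqVneq c 0; first by rewrite scale0r add0r; apply: Wker.
rewrite linearD linearZ => /eqP; rewrite addr_eq0 => /eqP piw.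
case: nx; exists (- c^-1 *: w); first by rewrite -[_ *: _]addr0; apply: (Wlin).
by rewrite linearZ /= scaleNr -scalerN -piw scalerA mulVf // scale1r.
Qed.

(** The restriction of pi to a complement of its kernel is bijective; the
    section is its inverse. *)
Lemma linear_section : (forall y, exists x, pi x = y) ->
  exists2 s : Y -> X, linear s & cancel s pi.
Proof.
move=> pi_surj; have [W [W0 Wlin Wker Wsurj]] := exists_complement_ker.
have /choice[s sP] : forall y, exists w, W w /\ pi w = y.
  by move=> y; have [x <-] := pi_surj y; have [w] := Wsurj x; exists w.
exists s => [c u v|y]; last exact: (sP y).2.
apply/eqP; rewrite -subr_eq0; apply/eqP/Wker.
  rewrite [X in W X]addrC -[X in W (X + _)]scaleN1r; apply: (Wlin); last exact: (sP _).1.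
  by apply: (Wlin); exact: (sP _).1.
by rewrite linearB linearP !(sP _).2 subrr.
Qed.

End LinearSection.

(** * Additive maps out of free modules and tensor products *)

(** The maps to be built below are linear over a smaller ring than the one over
    which the source is free or a tensor product, so that the R-linear universal
    properties do not produce them. *)
Section FreeAddLift.
Variables (R : pzRingType) (K : choiceType) (X : zmodType).
Variable l : K -> R -> X.
Hypothesis lD : forall k, {morph l k : r s / r + s}.

Definition free_addlift (v : free R K) : X := \sum_(k <- msupp v) l k v@_k.

Fact free_addlift0 k : l k 0 = 0.
Proof. by apply: (addrI (l k 0)); rewrite -lD !addr0. Qed.

Lemma free_addlift_w (D : {fset K}) (v : free R K) : (msupp v `<=` D)%fset ->
  free_addlift v = \sum_(k <- D) l k v@_k.
Proof.
move=> sub; apply: big_fset_incl => // k _ kv.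
by rewrite mcoeff_outdom // free_addlift0.
Qed.

Lemma free_addliftD : {morph free_addlift : u v / u + v}.
Proof.
move=> u v; pose D := (msupp u `|` msupp v `|` msupp (u + v))%fset.
have subs w : w \in [:: u; v; u + v] -> (msupp w `<=` D)%fset.
  move=> hw; apply/fsubsetP=> k kw; rewrite !inE.
  by move: hw kw; rewrite !inE => /or3P[] /eqP-> ->; rewrite ?orbT.
rewrite !(@free_addlift_w D) ?subs ?inE ?eqxx ?orbT // -big_split /=.
by apply: eq_bigr => k _; rewrite mcoeffD lD.
Qed.

Lemma free_addlift_gen r k : free_addlift (r *: fgen R k) = l k r.
Proof.
have c1 : (r *: fgen R k : free R K)@_k = r by rewrite free_scaleE mcoeffUU mulr1.
rewrite (@free_addlift_w [fset k]%fset) ?big_seq_fset1 ?c1 //.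
apply/fsubsetP=> k'; rewrite -mcoeff_neq0 free_scaleE mcoeffU inE.
by rewrite (eq_sym k); case: (k' == k) => //; rewrite mulr0 eqxx.
Qed.

End FreeAddLift.

Lemma free_ind (R : pzRingType) (K : choiceType) (P : free R K -> Prop) :
    P 0 -> (forall r k, P (r *: fgen R k)) ->
    (forall u v, P u -> P v -> P (u + v)) ->
  forall v, P v.
Proof.
by move=> P0 Pg PD v; rewrite [v]free_sumE; apply: (big_ind P) => // k _.
Qed.

Section BalancedLift.
Variables (R : comPzRingType) (M N : lmodType R) (X : zmodType).
Variable b : M -> N -> X.
Hypothesis bDl : forall n, {morph b^~ n : m m' / m + m'}.
Hypothesis bDr : forall m, {morph b m : n n' / n + n'}.
Hypothesis bZ : forall r m n, b (r *: m) n = b m (r *: n).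

(** An additive map f on the free module on M * N, induced by b, has to vanish
    on the R-span of the tensor relations.  Since ker f need not be an
    R-submodule, the span is compared with the largest R-submodule that ker f
    contains. *)
Section Kernel.
Variable f : free R (M * N)%type -> X.
Hypothesis fD : {morph f : u v / u + v}.
Hypothesis fE : forall r m n, f (r *: fgen R (m, n)) = b (r *: m) n.

Let core : {pred free R (M * N)%type} := fun v => `[< forall r, f (r *: v) = 0 >].

Let f0 : f 0 = 0.
Proof. by apply: (addrI (f 0)); rewrite -fD !addr0. Qed.

Let fB u v : f u = f v -> f (u - v) = 0.
Proof. by move=> e; apply: (addIr (f v)); rewrite -fD subrK add0r. Qed.

Let core_closed : subsemimod_closed core.
Proof.
split=> [|r v /asboolP v0]; last by apply/asboolP=> s; rewrite scalerA.
split=> [|u v /asboolP u0 /asboolP v0]; apply/asboolP=> s; first by rewrite scaler0.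
by rewrite scalerDr fD u0 v0 addr0.
Qed.

HB.instance Definition _ := GRing.isAddClosed.Build _ core core_closed.1.
HB.instance Definition _ := GRing.isScaleClosed.Build R _ core core_closed.2.

Lemma balanced_tensor_rel0 v : v \in lspan (@tensor_rel R M N) -> f v = 0.
Proof.
move=> /asboolP/(_ core) hv; have /asboolP/(_ 1) : v \in core; last by rewrite scale1r.
apply: hv => {v} _ [m m' n|m n n'|r m n|r m n]; apply/asboolP=> s;
  rewrite scalerBr; apply: fB; rewrite fE.
- by rewrite [X in _ = f X]scalerDr fD !fE scalerDr bDl.
- by rewrite [X in _ = f X]scalerDr fD !fE bDr.
- by rewrite [X in _ = f X]scalerA fE scalerA.
- by rewrite [X in _ = f X]scalerA fE -bZ scalerA mulrC.
Qed.

End Kernel.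

(** The universal property of the tensor product with respect to balanced maps
    into an abelian group, as opposed to bilinear maps into an R-module. *)
Lemma balanced_lift : exists2 f : tensor M N -> X,
  {morph f : t u / t + u} & forall m n, f (tens m n) = b m n.
Proof.
pose l (mn : M * N) (r : R) := b (r *: mn.1) mn.2.
have lD mn : {morph l mn : r s / r + s}.
  by move=> r s; rewrite /l scalerDl bDl.
pose f := free_addlift l; have fD : {morph f : u v / u + v} := free_addliftD lD.
have fE r m n : f (r *: fgen R (m, n)) = b (r *: m) n := free_addlift_gen lD r (m, n).
have fP u v : lquot_pi (lspan (@tensor_rel R M N)) u = lquot_pi _ v -> f u = f v.
  move=> /lquot_piP/(balanced_tensor_rel0 fD fE) e.
  by rewrite -[u](subrK v) fD e add0r.
exists (fun t => f (lquot_repr t)) => [t u|m n].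
  by rewrite -fD; apply: fP; rewrite lquot_piD !lquot_reprK.
have -> : b m n = f (fgen R (m, n)) by rewrite -[fgen _ _]scale1r fE scale1r.
by rewrite tens.unlock; apply: fP; rewrite lquot_reprK.
Qed.

End BalancedLift.

(** * Modules regarded over a smaller ring *)

(** S-linearity of maps between R-modules, for the S-module structures obtained
    by restriction along j.  As a property of plain functions it allows the same
    map to be used as a map of R-modules and of S-modules. *)
Definition linear_along (S R : pzRingType) (j : S -> R) (X Y : lmodType R)
    (f : X -> Y) : Prop :=
  forall s u v, f (j s *: u + v) = j s *: f u + f v.

Section LinearAlong.
Variables (S R : pzRingType) (j : {rmorphism S -> R}).

Section Basics.
Variables (X Y : lmodType R) (f : X -> Y).
Hypothesis fl : linear_along j f.

Lemma linear_alongD : {morph f : u v / u + v}.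
Proof. by move=> u v; have := fl 1 u v; rewrite rmorph1 !scale1r. Qed.

Lemma linear_along0 : f 0 = 0.
Proof. by apply: (addrI (f 0)); rewrite -linear_alongD !addr0. Qed.

Lemma linear_alongZ s u : f (j s *: u) = j s *: f u.
Proof. by rewrite -[_ *: u]addr0 fl linear_along0 addr0. Qed.

End Basics.

Lemma linear_along_comp (X Y Z : lmodType R) (f : X -> Y) (g : Y -> Z) :
  linear_along j f -> linear_along j g -> linear_along j (g \o f).
Proof. by move=> fl gl s u v /=; rewrite fl gl. Qed.

Lemma linear_linear_along (X Y : lmodType R) (f : {linear X -> Y}) :
  linear_along j f.
Proof. by move=> s u v; rewrite linearP. Qed.

(** Projectivity of Q as an S-module, but tested only on the surjections
    that are R-linear: this is all that the resolution requires. *)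
Definition projective_along (Q : lmodType R) : Prop :=
  forall (X Y : lmodType R) (pi : {linear X -> Y}),
    (forall y, exists x, pi x = y) ->
  forall g : Q -> Y, linear_along j g ->
  exists2 h : Q -> X, linear_along j h & forall q, pi (h q) = g q.

(** A free module is a direct sum of copies of R, so lifts can be chosen on each
    summand separately. *)
Lemma projective_along_free (K : choiceType) :
  projective_along R^o -> projective_along (free R K).
Proof.
move=> projR X Y pi pi_surj g gl.
have /choice[l lP] : forall x : K, exists h : R^o -> X,
    linear_along j h /\ forall r : R, pi (h r) = g (r *: fgen R x).
  move=> x; have [|h hl hE] := projR X Y pi pi_surj (fun r : R => g (r *: fgen R x)).
    by move=> s u v; rewrite scalerDl -gl -scalerA.
  by exists h.
have lD x : {morph l x : r s / r + s} := linear_alongD (lP x).1.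
have hD := free_addliftD lD; have hE := free_addlift_gen lD.
exists (free_addlift l) => [s u v|q].
  rewrite hD; congr (_ + _); elim/free_ind: u => [|r x|u w IHu IHw].
  - rewrite scaler0; have h0 : free_addlift l 0 = 0.
      by apply: (addrI (free_addlift l 0)); rewrite -hD !addr0.
    by rewrite h0 scaler0.
  - by rewrite scalerA !hE; exact: (linear_alongZ (lP x).1).
  - by rewrite scalerDr !hD IHu IHw scalerDr.
elim/free_ind: q => [|r x|u w IHu IHw].
- by rewrite (linear_along0 gl) /free_addlift msupp0 big_seq_fset0 linear0.
- by rewrite hE (lP x).2.
- by rewrite hD linearD IHu IHw (linear_alongD gl).
Qed.

(** An S-linear section s of e makes lkernel e an S-direct summand of P, with
    projection 1 - s e. *)
Section Kernel.
Variables (P Q : lmodType R) (e : {linear P -> Q}).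
Variable s : Q -> P.
Hypotheses (sl : linear_along j s) (sK : cancel s e).

Fact ker_retract_subproof p : lker_pred e (p - s (e p)).
Proof. by apply/eqP; rewrite linearB sK subrr. Qed.

Definition ker_retract (p : P) : lkernel e := LKernel (ker_retract_subproof p).

Lemma ker_retractE p : val (ker_retract p) = p - s (e p).
Proof. by []. Qed.

Lemma ker_retractK z : ker_retract (val z) = z.
Proof.
apply: val_inj; rewrite ker_retractE.
by move/eqP: (lkernel_valP z) => ->; rewrite (linear_along0 sl) subr0.
Qed.

Lemma ker_retract_linear_along : linear_along j ker_retract.
Proof.
move=> b u v; apply: val_inj; rewrite linearP !ker_retractE linearP sl.
by rewrite opprD addrACA scalerBr.
Qed.

Lemma projective_along_ker : projective_along P -> projective_along (lkernel e).
Proof.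
move=> projP X Y pi pi_surj g gl.
have [h hl hE] := projP X Y pi pi_surj (g \o ker_retract)
  (linear_along_comp ker_retract_linear_along gl).
exists (h \o val) => [|q]; last by rewrite /= hE /= ker_retractK.
exact: (linear_along_comp (@linear_linear_along _ _ val) hl).
Qed.

End Kernel.
End LinearAlong.

(** The same splitting for modules over a k-algebra, by restriction of scalars
    to k. *)
Lemma section_along (k : fieldType) (R : pzRingType) (j : {rmorphism k -> R})
    (X Y : lmodType R) (pi : {linear X -> Y}) :
  (forall y, exists x, pi x = y) ->
  exists2 s : Y -> X, linear_along j s & cancel s pi.
Proof.
move=> pi_surj; have pil : linear (pi : restr j X -> restr j Y).
  by move=> c u v; exact: linearP.
pose piL := GRing.isLinear.Build k (restr j X) (restr j Y) _ pi pil.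
pose pik : {linear restr j X -> restr j Y} := HB.pack (pi : restr j X -> restr j Y) piL.
have [|s sl sK] := @linear_section k _ _ pik; first exact: pi_surj.
by exists s.
Qed.

(** * B (x)_k B is projective over B *)

Section TensorSquare.
Variables (k : fieldType) (B : comPzRingType) (kB : {rmorphism k -> B}).

Local Notation R := (tensA kB kB).
Local Notation i := (tinl kB kB).
Local Notation j := (tinr kB kB).

Lemma ptensE b c : ptens kB kB b c = j c * i b.
Proof. by rewrite /tinl /tinr ptensM mul1r mulr1. Qed.

Section Lift.
Variables (X Y : lmodType R) (pi : {linear X -> Y}).
Variables (g : R^o -> Y) (t : Y -> X).
Hypotheses (gl : linear_along j g) (tl : linear_along (j \o kB) t).
Hypothesis tK : cancel t pi.

Local Notation Bk := (restr kB B^o).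

(** B (x)_k B is induced from the k-module B (the left factor), so a B-linear
    map g on it amounts to the k-linear map g i on B, which can be lifted by
    composition with a k-linear section t of pi. *)
Fact tensor_square_lift_bilin :
  @bilin k Bk Bk (restr (j \o kB) X) (fun b c => j c *: t (g (i b))).
Proof.
split=> [c x b b'|b x c c'] /=.
  have -> : i (x *: (b : Bk) + b') = j (kB x) * i b + i b'.
    by rewrite -tinlf_tinrg -rmorphM -rmorphD.
  rewrite gl (tl x) scalerDr; congr (_ + _).
  rewrite /= -[RHS]/(j (kB x) *: (j c *: t (g (i b)))).
  by rewrite [LHS]scalerA [RHS]scalerA mulrC.
have -> : j (x *: (c : Bk) + c') = j (kB x) * j c + j c'.
  by rewrite -rmorphM -rmorphD.
by rewrite scalerDl -scalerA.
Qed.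

Let h : R^o -> X := tensor_lift tensor_square_lift_bilin.

Let hD : {morph h : r s / r + s}.
Proof. exact: (linearD (tensor_lift tensor_square_lift_bilin)). Qed.

Let hE b c : h (ptens kB kB b c) = j c *: t (g (i b)).
Proof. exact: (tensor_lift_tens tensor_square_lift_bilin). Qed.

Lemma tensor_square_lift :
  exists2 h : R^o -> X, linear_along j h & forall q, pi (h q) = g q.
Proof.
exists h => [b u v|q].
  rewrite hD; congr (_ + _); elim/tensA_ind: u => [x y|u w IHu IHw].
    by rewrite [_ *: _]ptensM mul1r !hE rmorphM [RHS]scalerA.
  by rewrite scalerDr !hD IHu IHw scalerDr.
elim/tensA_ind: q => [x y|u w IHu IHw].
  by rewrite hE linearZ /= tK -(linear_alongZ gl) ptensE.
by rewrite hD linearD IHu IHw (linear_alongD gl).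
Qed.

End Lift.

Lemma projective_along_tensor_square : projective_along j R^o.
Proof.
move=> X Y pi pi_surj g gl.
have [t tl tK] := section_along (j \o kB) pi_surj.
exact: (tensor_square_lift gl tl tK).
Qed.

End TensorSquare.

(** * Tor of an extended module *)

(** The two properties that the functor P |-> M (x)_R P has when M is the
    extension R (x)_S C of an S-module C, and u : C -> M the canonical map.  It
    is then the functor C (x)_S P: pure tensors with first factor in the image of
    u generate, and maps that are S-linear act on the second factor. *)
Definition extended_along (S R : comPzRingType) (j : S -> R) (M : lmodType R)
    (C : Type) (u : C -> M) : Prop :=
  (forall (P : lmodType R) (F : tensor M P -> Prop),
     (forall c p, F (tens (u c) p)) -> (forall t t', F t -> F t' -> F (t + t')) ->
     forall t, F t) /\
  (forall (P P' : lmodType R) (f : P -> P'), linear_along j f ->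
     exists2 T : tensor M P -> tensor M P',
       {morph T : t t' / t + t'} & forall c p, T (tens (u c) p) = tens (u c) (f p)).

Lemma lmod_iso_trans (R : pzRingType) (U V W : lmodType R) :
  lmod_iso U V -> lmod_iso V W -> lmod_iso U W.
Proof.
by move=> [f f_bij] [g g_bij]; exists (g \o f : {linear U -> W}); apply: bij_comp.
Qed.

(** Homology at the end of a complex is a cokernel. *)
Lemma homology0_iso (R : pzRingType) (X Y Z D : lmodType R)
    (f : {linear X -> Y}) (g : {linear Y -> Z}) (q : {linear Y -> D}) :
  (forall y, g y = 0) -> (forall d, exists y, q y = d) ->
  (forall y, q y = 0 <-> exists x, f x = y) ->
  lmod_iso (homology f g) D.
Proof.
move=> g0 q_surj q_ker; pose i : {linear lkernel g -> Y} := val.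
have qi0 v : v \in @boundary_pred R X Y Z f g -> (q \o i) v = 0.
  by move=> /asboolP fv; apply/q_ker.
pose qb : {linear homology f g -> D} := lquot_lift qi0.
exists qb.
have /choice[r rP] : forall d, exists x, qb x = d.
  move=> d; have [y <-] := q_surj d.
  have yP : lker_pred g y by apply/eqP.
  by exists (lquot_pi _ (LKernel yP)); rewrite [LHS]lquot_lift_pi.
exists r => // x; have : qb (r (qb x) - x) = 0 by rewrite linearB rP subrr.
move: (r _ - x) (subrK x (r (qb x))) => w <-; rewrite -[w]lquot_reprK.
rewrite [LHS]lquot_lift_pi => /q_ker fw.
have -> : lquot_pi (@boundary_pred R X Y Z f g) (lquot_repr w) = 0; last first.
  by rewrite add0r.
rewrite -[RHS](linear0 (lquot_pi _)); apply/lquot_piP; rewrite subr0.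
exact/asboolP.
Qed.

Section Resolution.
Variables (S R : comPzRingType) (j : {rmorphism S -> R}) (N : lmodType R).
Hypotheses (projR : projective_along j R^o) (projN : projective_along j N).

Local Notation eval n := (@free_eval R (syz N n)).

Lemma projective_along_section (P Q : lmodType R) (e : {linear P -> Q}) :
  (forall q, exists p, e p = q) -> projective_along j Q ->
  exists2 s : Q -> P, linear_along j s & cancel s e.
Proof.
move=> e_surj projQ; have [|s sl sK] := projQ P Q e e_surj id; first by [].
by exists s.
Qed.

(** The n-th syzygy is the kernel of an S-split surjection from a free
    module. *)
Lemma projective_along_syz n : projective_along j (syz N n).
Proof.
elim: n => [|n IHn]; first exact: projN.
have [s sl sK] := projective_along_section (@free_eval_surj R (syz N n)) IHn.
exact: (projective_along_ker sl sK (projective_along_free projR)).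
Qed.

Lemma syz_section n : exists2 s : syz N n -> resol N n,
  linear_along j s & cancel s (eval n).
Proof.
apply: (@projective_along_section (resol N n) _ (eval n)); last first.
  exact: projective_along_syz.
exact: free_eval_surj.
Qed.

(** The homotopy is h = s' (1 - s e), where e : resol n -> syz n is the
    evaluation and 1 - s e takes its values in the next syzygy.  In the second
    equation, 1 - s e is the identity on boundaries, which lie in this syzygy.
    The first equation for n+1 and the second one for n, with a common section
    of eval n.+1, add up to d h + h d = 1. *)
Lemma resol_homotopy n (s : syz N n -> resol N n)
    (s' : syz N n.+1 -> resol N n.+1) :
  linear_along j s -> cancel s (eval n) ->
  linear_along j s' -> cancel s' (eval n.+1) ->
  exists2 h : resol N n -> resol N n.+1, linear_along j h &
    (forall p, resol_d (h p) + s (eval n p) = p) /\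
    (forall p, h (resol_d p) = s' (eval n.+1 p)).
Proof.
move=> sl sK s'l s'K; pose r := ker_retract sK.
exists (s' \o r).
  exact: (linear_along_comp (ker_retract_linear_along sl sK) s'l).
split=> p /=; last by congr s'; apply: (ker_retractK sl sK).
by rewrite /resol_d s'K [lkernel_val _]ker_retractE subrK.
Qed.

Variables (M : lmodType R) (C : Type) (u : C -> M).
Hypothesis Mext : extended_along j u.

(** The identity d h' + h d = 1 survives on M (x)_R P although h and h' are only
    S-linear, since M is extended from S; so cycles are boundaries. *)
Lemma Tor_eq0 n (x : Tor M N n.+1) : x = 0.
Proof.
have [gen ext] := Mext.
have [s0 s0l s0K] := syz_section n.
have [s1 s1l s1K] := syz_section n.+1.
have [s2 s2l s2K] := syz_section n.+2.
have [h hl [_ hd]] := resol_homotopy s0l s0K s1l s1K.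
have [h' h'l [dh' _]] := resol_homotopy s1l s1K s2l s2K.
have [H HD HE] := ext _ _ h hl; have [H' H'D H'E] := ext _ _ h' h'l.
have split_id (z : tensor M (resol N n.+1)) :
    Tor_d M N n.+2 (H' z) + H (Tor_d M N n.+1 z) = z.
  elim/gen: z => [c p|z z' IH IH'].
    by rewrite H'E /= !tensor_map_tens HE -tensDr hd dh'.
  by rewrite H'D !linearD HD addrACA IH IH'.
rewrite -[x]lquot_reprK; set z := lquot_repr x.
rewrite -[0](linear0 (lquot_pi _)); apply/lquot_piP; rewrite subr0.
apply/asboolP; exists (H' (val z)).
rewrite -[RHS]split_id (eqP (lkernel_valP z)).
have -> : H 0 = 0 by apply: (addrI (H 0)); rewrite -HD !addr0.
by rewrite addr0.
Qed.

(** The same argument in degree 0, where the homotopy gives d h + s e = 1: the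
    kernel of M (x) e consists of the boundaries. *)
Lemma Tor0_iso : lmod_iso (Tor M N 0) (tensor M N).
Proof.
have [gen ext] := Mext.
have [s sl sK] := syz_section 0; have [s' s'l s'K] := syz_section 1.
have [h hl [dh _]] := resol_homotopy sl sK s'l s'K.
have [H HD HE] := ext _ _ h hl; have [sM sMD sME] := ext _ _ s sl.
pose e : {linear resol N 0 -> N} := @free_eval R N.
pose q : {linear tensor M (resol N 0) -> tensor M N} := tensor_map idfun e.
have qE m p : q (tens m p) = tens m (e p) := tensor_map_tens _ _ m p.
pose d : {linear tensor M (resol N 1) -> tensor M (resol N 0)} := Tor_d M N 1.
have dE m p : d (tens m p) = tens m (resol_d p) := tensor_map_tens _ _ m p.
have qD : {morph q : t t' / t + t'} := linearD q.
have dD : {morph d : t t' / t + t'} := linearD d.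
have split_id z : d (H z) + sM (q z) = z.
  elim/gen: z => [c p|z z' IH IH'].
    by rewrite HE qE dE sME -tensDr dh.
  by rewrite HD qD dD sMD addrACA IH IH'.
have q_surj t : exists z, q z = t.
  exists (sM t); elim/gen: t => [c p|t t' IH IH'].
    by rewrite sME qE; congr tens; apply: sK.
  by rewrite sMD qD IH IH'.
suff q_ker z : q z = 0 <-> exists w, d w = z.
  exact: (@homology0_iso _ _ _ _ _ _ _ q _ q_surj q_ker).
split=> [qz0|[w <-]].
  have sM0 : sM 0 = 0 by apply: (addrI (sM 0)); rewrite -sMD !addr0.
  by exists (H z); rewrite -[RHS]split_id qz0 sM0 addr0.
elim/tensor_ind: w => [m p|w w' IH IH']; last by rewrite dD qD IH IH' addr0.
rewrite dE qE.
have -> : e (resol_d p) = 0 by apply: (@resol_exact R N 0 _).2; exists p.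
by rewrite -(scale0r 0) tensZr scale0r.
Qed.

End Resolution.

(** * The diagonal bimodule of an algebra *)

Section TensorSquareTor.
Variables (k : fieldType) (B C : comPzRingType).
Variables (kB : {rmorphism k -> B}) (kC : {rmorphism k -> C}).
Variables (phi : {rmorphism B -> C}) (phik : forall x, phi (kB x) = kC x).

Local Notation R := (tensA kB kB).
Local Notation BC := (tensA kB kC).
Local Notation i := (tinl kB kB).
Local Notation j := (tinr kB kB).

Variables (iota : {rmorphism R -> BC}) (mu : {rmorphism R -> B}).
Hypothesis iotaE : forall x y, iota (ptens kB kB x y) = ptens kB kC x (phi y).
Hypothesis muE : forall x y, mu (ptens kB kB x y) = x * y.

Local Notation M := (restr iota BC^o).
Local Notation N := (restr mu B^o).

Let u (c : C) : M := tinr kB kC c.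

Let uD : {morph u : c c' / c + c'}.
Proof. exact: (rmorphD (tinr kB kC)). Qed.

Let uZ b c : u (phi b * c) = j b *: u c.
Proof. by rewrite [RHS]/(iota (j b) * _) iotaE [RHS]ptensM mul1r. Qed.

Let ptens_uE b c : (ptens kB kC b c : M) = i b *: u c.
Proof. by rewrite [RHS]/(iota (i b) * _) iotaE [RHS]ptensM rmorph1 mulr1 mul1r. Qed.

Let diagE (b : B) (v : N) : j b *: v = b * v :> B.
Proof. by rewrite [LHS]/(mu (j b) * _) muE mul1r. Qed.

Section Functoriality.
Variables (P P' : lmodType R) (f : P -> P').
Hypothesis fl : linear_along j f.

(** The map M (x)_R P -> M (x)_R P' that extends f sends
    (b (x) c) (x) p = u c (x) i(b) p to u c (x) f (i(b) p). *)
Fact extend_bilin p :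
  @bilin k (restr kB B^o) (restr kC C^o) (restr (j \o kB) (tensor M P'))
    (fun b c => tens (u c) (f (i b *: p))).
Proof.
split=> [c x b b'|b x c c'] /=.
  have -> : i (x *: (b : restr kB B^o) + b') = j (kB x) * i b + i b'.
    by rewrite -tinlf_tinrg -rmorphM -rmorphD.
  by rewrite scalerDl -scalerA fl tensDr tensZr.
have -> : u (x *: (c : restr kC C^o) + c') = j (kB x) *: u c + u c'.
  by rewrite uD -uZ phik.
by rewrite tensDl tensZl.
Qed.

Let ext p : M -> tensor M P' := tensor_lift (extend_bilin p).

Let extD p : {morph ext p : m m' / m + m'}.
Proof. exact: (linearD (tensor_lift (extend_bilin p))). Qed.

Let extE p b c : ext p (ptens kB kC b c) = tens (u c) (f (i b *: p)).
Proof. exact: (tensor_lift_tens (extend_bilin p)). Qed.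

Let extDr m : {morph ext^~ m : p p' / p + p'}.
Proof.
move=> p p'; elim/tensA_ind: m => [b c|m m' IH IH'] /=.
  by rewrite !extE scalerDr (linear_alongD fl) tensDr.
by rewrite !extD IH IH' addrACA.
Qed.

Let extZ r m p : ext p (r *: m) = ext (r *: p) m.
Proof.
elim/tensA_ind: m => [b c|m m' IH IH'] /=; last first.
  by rewrite scalerDr !extD IH IH'.
elim/tensA_ind: r => [x y|r r' IH IH'] /=; last first.
  by rewrite !scalerDl extD IH IH' -extDr.
have -> : (ptens kB kB x y : R) *: (ptens kB kC b c : M) = ptens kB kC (x * b) (phi y * c).
  by rewrite [LHS]/(iota _ * _) iotaE [LHS]ptensM.
rewrite !extE uZ tensZl -tensZr.
rewrite -(linear_alongZ fl) !scalerA; congr (tens _ (f (_ *: _))).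
by rewrite /tinl /tinr !ptensM !mul1r mulr1 mulrC.
Qed.

Lemma extend_along : exists2 T : tensor M P -> tensor M P',
  {morph T : t t' / t + t'} & forall c p, T (tens (u c) p) = tens (u c) (f p).
Proof.
have [T TD TE] := @balanced_lift _ _ _ _ (fun m p => ext p m) extD extDr extZ.
by exists T => // c p; rewrite TE extE rmorph1 scale1r.
Qed.

End Functoriality.

(** M is R (x)_B C: scalars of the left factor of M can be moved to P. *)
Lemma extended_along_tinr : extended_along j u.
Proof.
split=> [P F Fu FD t|]; last exact: extend_along.
elim/tensor_ind: t => // m p; elim/tensA_ind: m => [b c|m m' IH IH'].
  by rewrite ptens_uE tensZl -tensZr.
by rewrite tensDl; apply: FD.
Qed.

(** As mu j = id, N is free over B on the generator 1. *)
Lemma projective_along_diag : projective_along j N.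
Proof.
move=> X Y pi pi_surj g gl.
have [x xE] := pi_surj (g (1 : B)).
exists (fun b : N => j b *: x) => [b v w|v].
  by rewrite rmorphD diagE rmorphM scalerDl scalerA.
by rewrite linearZ /= xE -(linear_alongZ gl) diagE mulr1.
Qed.

Fact augmentation_subproof x : phi (kB x) = (idfun : {rmorphism C -> C}) (kC x).
Proof. exact: phik. Qed.

(** The base change of mu : R -> B along phi, from B (x)_k C to C. *)
Definition augmentation : {rmorphism BC -> C} := tensA_lift augmentation_subproof.
Local Notation psi := augmentation.

Let psiE b c : psi (ptens kB kC b c) = phi b * c.
Proof. exact: tensA_liftE. Qed.

Let psi_iota r : psi (iota r) = phi (mu r).
Proof.
elim/tensA_ind: r => [x y|r r' IH IH']; last by rewrite !rmorphD IH IH'.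
by rewrite iotaE psiE muE rmorphM.
Qed.

Let psi_u c : psi (u c) = c.
Proof. by rewrite [LHS]psiE rmorph1 mul1r. Qed.

Local Notation D := (restr (phi \o mu) C^o).

Fact augmentation_bilin : @bilin R M N D (fun m b => psi m * phi b).
Proof.
split=> [b r m m'|m r b b'] /=.
  rewrite rmorphD mulrDl; congr (_ + _).
  by rewrite [_ *: _]/(iota r * m) rmorphM psi_iota -mulrA.
rewrite rmorphD mulrDr; congr (_ + _).
by rewrite [_ *: b]/(mu r * b) rmorphM mulrCA.
Qed.

(** The inverse isomorphism is c |-> u c (x) 1. *)
Lemma tensor_diag_iso : lmod_iso (tensor M N) D.
Proof.
pose q : {linear tensor M N -> D} := tensor_lift augmentation_bilin.
have qE m b : q (tens m b) = psi m * phi b := tensor_lift_tens _ m b.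
exists q; exists (fun c => tens (u c) ((1 : B) : N)) => [t|c]; last first.
  by rewrite [LHS]qE psi_u rmorph1 mulr1.
elim/extended_along_tinr.1: t => [c b|t t' IH IH'].
  rewrite qE psi_u mulrC uZ tensZl -tensZr; congr tens.
  by rewrite diagE mulr1.
by rewrite linearD uD tensDl IH IH'.
Qed.

Lemma Tor0_tensor_square : lmod_iso (Tor M N 0) D.
Proof.
exact: (lmod_iso_trans (Tor0_iso (@projective_along_tensor_square k B kB)
  projective_along_diag extended_along_tinr) tensor_diag_iso).
Qed.

Lemma Tor_tensor_square_eq0 n (x : Tor M N n.+1) : x = 0.
Proof.
exact: (Tor_eq0 (@projective_along_tensor_square k B kB) projective_along_diag
  extended_along_tinr).
Qed.

End TensorSquareTor.

Theorem theorem4p1 (k : fieldType) (p : nat) (charkp : p \in [pchar k]) (N : nat)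
    (A : comPzRingType) (a : {rmorphism k -> A}) :
  let T := Tor (restr (id_relfrob charkp N a) (Atilde_A charkp N a)^o)
               (restr (Atilde_mul charkp N a) (Atilde charkp N a)^o) in
  lmod_iso (T 0%N)
    (restr (relfrob charkp N a \o Atilde_mul charkp N a) A^o) /\
  (forall i : nat, (0 < i)%N -> forall x : T i, x = 0).
Proof.
have phik x : relfrob charkp N a (Atilde_alg charkp N a x) = a x.
  by rewrite /= relfrobE expr1n mulr1.
split=> [|[//|n] _ x].
  exact: (Tor0_tensor_square phik (@id_relfrobE _ _ charkp N _ a)
    (@Atilde_mulE _ _ charkp N _ a)).
exact: (Tor_tensor_square_eq0 phik (@id_relfrobE _ _ charkp N _ a)
  (@Atilde_mulE _ _ charkp N _ a)).
Qed.
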